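(* If $G$ is a connected graph of order $n$, then $$b(G)\leq \left\lceil\frac{-3+\sqrt{24n+33}}{4}\right\rceil,$$ where $b(G)$ denotes the burning number of $G$.
   Context: Burning process on a finite graph $G$: initially all vertices are unburned. In each round, every already burned vertex spreads fire to all of its neighbors, which become burned, and at the same time one chooses an unburned vertex (if any remains) and changes its status to burned; burned vertices remain burned. The burning number $b(G)$ is the minimum number of rounds needed to burn all vertices of $G$. The order of $G$ is its number of vertices. *)

(* Defs.v *)
From HB Require Import structures.
From mathcomp Require Import all_boot all_order all_algebra.
Set Implicit Arguments. Unset Strict Implicit. Unset Printing Implicit Defensive.
Import Order.TTheory GRing.Theory Num.Theory.

Definition simple_graph (T : finType) (e : rel T) : Prop :=
  symmetric e /\ irreflexive e.

Definition connected_graph (T : finType) (e : rel T) : Prop :=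
  forall x y : T, connect e x y.

Definition spread (T : finType) (e : rel T) (B : {set T}) : {set T} :=
  [set v | (v \in B) || [exists u in B, e u v]].

Definition burned (T : finType) (e : rel T) (s : seq T) : {set T} :=
  foldl (fun B x => x |: spread e B) set0 s.

Definition valid_burning (T : finType) (e : rel T) (s : seq T) : bool :=
  [forall i : 'I_(size s), tnth (in_tuple s) i \notin burned e (take i s)].

Definition burns_in (T : finType) (e : rel T) (k : nat) : bool :=
  [exists t : k.-tuple T, valid_burning e t && (burned e t == setT)].

(* Burning number: least k such that the graph is burned in k rounds
   (any valid burning sequence has distinct vertices, so k <= #|T|). *)
Definition burning_number (T : finType) (e : rel T) : nat :=
  find (burns_in e) (iota 0 #|T|.+1).

(* Main.v *)
Require Import Defs.
From mathcomp Require Import all_boot all_order all_algebra.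
From mathcomp Require Import zify lra.
Import Order.TTheory GRing.Theory Num.Theory.
Set Implicit Arguments. Unset Strict Implicit. Unset Printing Implicit Defensive.

(** A burning sequence of length [k] amounts to a cover by balls of radii [0, ..., k - 1],
    and it suffices to cover a breadth-first spanning tree. Reserve the radii
    [0, ..., s - 1] with [s] about [k / 3], keep the largest radius [K = k - 1] for the end,
    and prune subtrees, each other radius [rho] paying for [rho + s + 1] vertices.

    Let [r] be the largest radius left besides [K], and [u] a lowest vertex whose subtree has
    diameter more than [2 r]. Each child subtree of [u] lies in a ball of radius [r], so if it
    has more than [r + s] vertices it is pruned. Otherwise the two tallest child subtrees
    together have at least [2 r + 1] vertices, and a ball of radius [r] at (or near) [u]
    misses only short tips of them, each of which fits into one reserved ball. Spending a
    reserved ball lowers [s], which costs one vertex per remaining radius. When two reserved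
    balls are needed, one of the two subtrees is so large that every radius in a long interval
    would have pruned it; hence these radii are already used up and the cost is small. *)

(** * Rooted trees *)

Record rooted_tree (V : finType) := RootedTree {
  tree_root : V;
  par : V -> V;
  depth : V -> nat;
  par_root : par tree_root = tree_root;
  depth_eq0 : forall v, (depth v == 0) = (v == tree_root);
  depth_par : forall v, depth (par v) = (depth v).-1 }.

Section Tree.
Variables (V : finType) (t : rooted_tree V).
Local Notation par := (par t).
Local Notation d := (depth t).
Local Notation root := (tree_root t).
Implicit Types (S : {set V}) (u v w x y c : V).

Definition desc v y := iter (d y - d v) par y == v.
Definition subtree S w := [set y in S | desc w y].
Definition par_closed S := forall y, y \in S -> par y \in S.
Definition reach m c y := exists a b, a + b <= m /\ iter a par c = iter b par y.

Lemma depth_iter i y : d (iter i par y) = d y - i.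
Proof. by elim: i => [|i IH] /=; rewrite ?subn0 // depth_par IH subnS. Qed.

Lemma depth_root : d root = 0.
Proof. by apply/eqP; rewrite depth_eq0. Qed.

Lemma desc_depth v y : desc v y -> d v <= d y.
Proof. move/eqP/(congr1 d); rewrite depth_iter; lia. Qed.

Lemma desc_refl v : desc v v.
Proof. by rewrite /desc subnn. Qed.

Lemma desc_root y : desc root y.
Proof. by rewrite /desc -depth_eq0 depth_iter depth_root subn0 subnn. Qed.

Lemma desc_iter i y : i <= d y -> desc (iter i par y) y.
Proof. by move=> ?; rewrite /desc depth_iter subKn. Qed.

Lemma desc_trans v w y : desc v w -> desc w y -> desc v y.
Proof.
move=> vw wy; have := desc_depth vw; have := desc_depth wy.
move: vw wy; rewrite /desc => /eqP vw /eqP wy le1 le2.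
have -> : d y - d v = (d w - d v) + (d y - d w) by lia.
by rewrite iterD wy vw.
Qed.

Lemma desc_par v y : v != root -> desc v y -> desc (par v) y.
Proof.
rewrite -depth_eq0 => v0 vy; apply: desc_trans vy.
by rewrite /desc depth_par (_ : _ - _ = 1) //=; lia.
Qed.

Lemma desc_of_par v y : desc v (par y) -> desc v y.
Proof.
case: (eqVneq y root) => [->|]; first by rewrite par_root.
rewrite -depth_eq0 => y0 vy; apply: desc_trans vy _.
by rewrite /desc depth_par (_ : _ - _ = 1) //=; lia.
Qed.

Lemma closed_iter S i y : par_closed S -> y \in S -> iter i par y \in S.
Proof. by move=> cS yS; elim: i => //= i; apply: cS. Qed.

Lemma closed_setD_subtree S A w : par_closed (S :\: A) -> par_closed (S :\: (subtree S w :|: A)).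
Proof.
move=> cS y; rewrite !inE !negb_or !negb_and => /andP[/andP[wy yA] yS].
have := cS y; rewrite !inE yA yS => /(_ isT) /andP[-> pS]; rewrite pS !andbT /=.
by move: wy; rewrite yS; apply/contraNN/desc_of_par.
Qed.

Lemma root_setD_subtree S A w : w != root -> root \in S :\: A -> root \in S :\: (subtree S w :|: A).
Proof.
move=> w0; rewrite !inE => /andP[/negbTE -> ->]; rewrite orbF andbT /=.
by rewrite /desc depth_root sub0n /= eq_sym w0.
Qed.

Lemma subtree_iter S w x i : par_closed S -> x \in subtree S w -> i <= d x - d w ->
  iter i par x \in subtree S w.
Proof.
move=> cS; rewrite !inE => /andP[xS wx] le; rewrite closed_iter //=.
move: wx; rewrite /desc depth_iter => /eqP {2}<-; rewrite -iterD; apply/eqP.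
by congr (iter _ par x); lia.
Qed.

Lemma subtree_lca S w x y : par_closed S -> x \in subtree S w -> y \in subtree S w ->
  exists i j, [/\ i <= d x - d w, j <= d y - d w, d x - i = d y - j,
    iter i par x = iter j par y & (d x - d w).+1 + j <= #|subtree S w|].
Proof.
move=> cS xW yW.
have [xw yw] : desc w x /\ desc w y by move: xW yW; rewrite !inE => /andP[_ ->] /andP[_ ->].
have [ldx ldy] := (desc_depth xw, desc_depth yw).
have ex : exists i, desc (iter i par x) y.
  by exists (d x - d w); move/eqP: xw => ->.
case: (ex_minnP ex) => i Pi mini; set a := iter i par x in Pi.
have le_i : i <= d x - d w by apply: mini; move/eqP: xw => ->.
have da : d a = d x - i by rewrite depth_iter.
have dy := desc_depth Pi.
exists i, (d y - d a); split => //; [lia | lia | by move/eqP: Pi => -> |].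
set cx := [seq iter k par x | k <- iota 0 (d x - d w).+1].
set cy := [seq iter k par y | k <- iota 0 (d y - d a)].
suff un : uniq (cx ++ cy).
  rewrite cardE; apply: leq_trans (_ : size (cx ++ cy) <= _).
    by rewrite size_cat !size_map !size_iota.
  apply: uniq_leq_size => // z; rewrite mem_cat mem_enum => /orP[] /mapP[k].
    by rewrite mem_iota => ? ->; apply: subtree_iter => //; lia.
  by rewrite mem_iota => ? ->; apply: subtree_iter => //; lia.
rewrite cat_uniq; apply/and3P; split.
- rewrite map_inj_in_uniq ?iota_uniq // => k l; rewrite !mem_iota => kk ll /(congr1 d).
  rewrite !depth_iter; lia.
- apply/hasPn => z /mapP[k]; rewrite mem_iota => kk ->; apply/negP => /mapP[l].
  rewrite mem_iota => ll eq_kl; have := congr1 d eq_kl; rewrite !depth_iter => eq_d.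
  have : i <= l by apply: mini; rewrite -eq_kl desc_iter //; lia.
  lia.
- rewrite map_inj_in_uniq ?iota_uniq // => k l; rewrite !mem_iota => kk ll /(congr1 d).
  rewrite !depth_iter; lia.
Qed.

Lemma reach_low m x y i j : i <= m -> j <= i -> iter i par x = iter j par y ->
  reach m (iter m par x) y.
Proof.
move=> im ji eq_ij; exists 0, (m - i + j); split; first by lia.
by rewrite /= [in RHS]iterD -eq_ij -iterD; congr iter; lia.
Qed.

Lemma reach_high m x y i j : m <= i -> i - m + j <= m -> iter i par x = iter j par y ->
  reach m (iter m par x) y.
Proof. by move=> im le eq_ij; exists (i - m), j; split => //; rewrite -iterD subnK. Qed.

Lemma reach_down m u y : desc u y -> d y - d u <= m -> reach m u y.
Proof. by move=> /eqP uy le; exists 0, (d y - d u); rewrite add0n /= uy. Qed.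

Lemma deepest (A : {set V}) z : z \in A -> exists2 x, x \in A & forall y, y \in A -> d y <= d x.
Proof. by move=> zA; case: (arg_maxnP d zA) => x xA H; exists x => // y; apply: H. Qed.

Lemma subtree_height S w x : par_closed S -> x \in subtree S w ->
  (d x - d w).+1 <= #|subtree S w|.
Proof. by move=> cS xW; have [i [j [_ _ _ _]]] := subtree_lca cS xW xW; lia. Qed.

Lemma subtree_tips S w q m : par_closed S -> #|subtree S w| <= q + m + 1 ->
  exists c, forall y, y \in subtree S w -> q <= d y - d w -> reach m c y.
Proof.
move=> cS cardW; case: (set_0Vmem (subtree S w)) => [->|[z zW]].
  by exists root => y; rewrite inE.
have [x xW xmax] := deepest zW; exists (iter m par x) => y yW qy.
have [i [j [li lj e1 e2 cW]]] := subtree_lca cS xW yW.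
have := xmax _ yW; have wy : d w <= d y by move: yW; rewrite inE => /andP[_ /desc_depth].
have [im|im] := leqP i m => le_yx; last by lia.
by apply: reach_low e2 => //; lia.
Qed.

Lemma subtree_small S w m : par_closed S -> #|subtree S w| <= m.*2.+1 ->
  exists c, forall y, y \in subtree S w -> reach m c y.
Proof.
move=> cS cardW; case: (set_0Vmem (subtree S w)) => [->|[z zW]].
  by exists root => y; rewrite inE.
have [x xW xmax] := deepest zW; exists (iter m par x) => y yW.
have [i [j [li lj e1 e2 cW]]] := subtree_lca cS xW yW.
have := xmax _ yW; have wy : d w <= d y by move: yW; rewrite inE => /andP[_ /desc_depth].
have [im|im] := leqP i m => le_yx.
  by apply: reach_low e2 => //; lia.
by apply: reach_high e2; lia.
Qed.

Lemma subtree_root S : subtree S root = S.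
Proof. by apply/setP => y; rewrite inE desc_root andbT. Qed.

Definition near m x y :=
  [exists i : 'I_(d x).+1, exists j : 'I_(d y).+1,
    (i + j <= m) && (iter i par x == iter j par y)].

Lemma near_via m u x y : desc u x -> desc u y -> (d x - d u) + (d y - d u) <= m -> near m x y.
Proof.
move=> ux uy le; have lx : d x - d u < (d x).+1 by lia.
have ly : d y - d u < (d y).+1 by lia.
apply/existsP; exists (Ordinal lx); apply/existsP; exists (Ordinal ly) => /=.
by rewrite le (eqP ux) (eqP uy) eqxx.
Qed.

Lemma near_reach m x y : near m.*2 x y -> d y <= d x -> reach m (iter m par x) y.
Proof.
case/existsP => i /existsP[j /andP[le /eqP eq_ij]] yx.
have := congr1 d eq_ij; rewrite !depth_iter => eq_d.
have := ltn_ord i; have := ltn_ord j => lj li.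
have [im|im] := leqP i m; first by apply: reach_low eq_ij => //; lia.
by apply: reach_high eq_ij; lia.
Qed.

Definition small_diam S m w :=
  [forall x in subtree S w, forall y in subtree S w, near m x y].

Definition branch S m u w x :=
  [/\ w != root, par w = u, x \in subtree S w,
      forall y, y \in subtree S w -> d y <= d x
    & forall y, y \in subtree S w -> reach m (iter m par x) y].

Lemma child_toward S u x : x \in subtree S u -> x != u ->
  let w := iter (d x - d u).-1 par x in
  [/\ w != root, par w = u, x \in subtree S w & d w = (d u).+1].
Proof.
rewrite inE => /andP[xS ux] xu /=; have le := desc_depth ux.
have lt : d u < d x.
  by rewrite ltn_neqAle le andbT; apply: contraNneq xu => eq_d; rewrite -(eqP ux) eq_d subnn.
have dw : d (iter (d x - d u).-1 par x) = (d u).+1 by rewrite depth_iter; lia.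
split=> //; first by rewrite -depth_eq0 dw.
  by rewrite -iterS prednK ?(eqP ux) //; lia.
by rewrite inE xS desc_iter //; lia.
Qed.

Lemma subtree_child S u w y : w != root -> par w = u -> y \in subtree S w -> y \in subtree S u.
Proof. by move=> w0 <-; rewrite !inE => /andP[-> /(desc_par w0)->]. Qed.

Lemma desc_same_depth v w y : d v = d w -> desc v y -> desc w y -> v = w.
Proof. by rewrite /desc => -> /eqP <- /eqP. Qed.

Lemma split_tree S m : par_closed S -> root \in S ->
  [\/ exists c, forall y, y \in S -> reach m c y,
      exists u w x, branch S m u w x /\ m.*2 < d x - d u
    | exists u w1 x1 w2 x2, [/\ branch S m u w1 x1, branch S m u w2 x2, w1 != w2
        & m.*2 < (d x1 - d u) + (d x2 - d u)] /\ d x2 <= d x1].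
Proof.
move=> cS rS.
have small_cover w x : small_diam S m.*2 w -> x \in subtree S w ->
    (forall y, y \in subtree S w -> d y <= d x) ->
    forall y, y \in subtree S w -> reach m (iter m par x) y.
  move=> sw xW mx y yW; apply: near_reach; last exact: mx.
  by move/forall_inP: sw => /(_ x xW) /forall_inP /(_ y yW).
case: (set_0Vmem [set v in S | ~~ small_diam S m.*2 v]) => [eq0|[v vB]].
  have sr : small_diam S m.*2 root.
    by apply/negPn/negP => nr; move/setP: eq0 => /(_ root); rewrite !inE rS nr.
  have rR : root \in subtree S root by rewrite subtree_root.
  have [x xS mx] := deepest rR; constructor 1; exists (iter m par x) => y yS.
  by apply: (small_cover root) => //; rewrite subtree_root.
have {v vB} [u] := deepest vB; rewrite inE => /andP[uS nu] umax.
have child_small w : w \in S -> d w = (d u).+1 -> small_diam S m.*2 w.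
  by move=> wS dw; apply/negPn/negP => nw; have := umax w; rewrite inE wS nw dw ltnn => /(_ isT).
have uU : u \in subtree S u by rewrite inE uS desc_refl.
have [x1 x1U x1max] := deepest uU.
have [x0 [y0 [x0U y0U n0]]] : exists x0 y0,
    [/\ x0 \in subtree S u, y0 \in subtree S u & ~~ near m.*2 x0 y0].
  case/forall_inPn: nu => x0 x0U /forall_inPn[y0 y0U n0]; by exists x0, y0.
have x1u : x1 != u.
  apply: contraNneq n0 => eq_x; have [ux uy] : desc u x0 /\ desc u y0.
    by move: x0U y0U; rewrite !inE => /andP[_ ->] /andP[_ ->].
  apply: (near_via ux uy); move: (x1max _ x0U) (x1max _ y0U); rewrite eq_x -!subn_eq0.
  by move=> /eqP-> /eqP->.
have [] := child_toward x1U x1u; set w1 := iter _ par x1 => w1r pw1 x1W dw1.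
have w1S : w1 \in S by apply: closed_iter => //; move: x1W; rewrite inE => /andP[].
have x1m y : y \in subtree S w1 -> d y <= d x1.
  by move=> yW; apply: x1max; apply: subtree_child yW.
have sw1 := child_small _ w1S dw1.
have b1 : branch S m u w1 x1 by split=> //; apply: small_cover.
have uU' : u \in subtree S u :\: subtree S w1.
  by rewrite inE uU andbT inE uS /=; apply/negP => /desc_depth; rewrite dw1 ltnn.
have [x2] := deepest uU'; rewrite inE => /andP[x2W x2U] x2max.
have big : m.*2 < (d x1 - d u) + (d x2 - d u).
  have far a b : a \in subtree S u -> b \in subtree S u -> b \notin subtree S w1 ->
      ~~ near m.*2 a b -> m.*2 < (d x1 - d u) + (d x2 - d u).
    move=> aU bU bW nab; rewrite ltnNge; apply: contra nab => le.
    have [ua ub] : desc u a /\ desc u b.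
      by move: aU bU; rewrite !inE => /andP[_ ->] /andP[_ ->].
    apply: (near_via ua ub); apply: leq_trans le; apply: leq_add; apply: leq_sub2r.
      exact: x1max.
    by apply: x2max; rewrite inE bW bU.
  case: (boolP (y0 \in subtree S w1)) => y0W; last exact: (far x0 y0).
  case: (boolP (x0 \in subtree S w1)) => x0W.
    by move/forall_inP: sw1 n0 => /(_ x0 x0W) /forall_inP /(_ y0 y0W) ->.
  apply: (far y0 x0) => //; apply: contra n0 => /existsP[i /existsP[j /andP[le /eqP e]]].
  by apply/existsP; exists j; apply/existsP; exists i; rewrite addnC le e eqxx.
case: (eqVneq x2 u) => [eq2|x2u].
  by constructor 2; exists u, w1, x1; split=> //; move: big; rewrite eq2 subnn addn0.
have [] := child_toward x2U x2u; set w2 := iter _ par x2 => w2r pw2 x2W2 dw2.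
have w2S : w2 \in S by apply: closed_iter => //; move: x2W2; rewrite inE => /andP[].
have w12 : w1 != w2 by apply: contraNneq x2W => ->.
have x2m y : y \in subtree S w2 -> d y <= d x2.
  move=> yW; apply: x2max; rewrite inE (subtree_child w2r pw2 yW) andbT.
  apply/negP; move: yW; rewrite !inE => /andP[_ y2] /andP[_ y1].
  by rewrite (desc_same_depth _ y1 y2) ?eqxx // dw1 in w12.
have b2 : branch S m u w2 x2 by split=> //; apply: small_cover => //; apply: child_small.
by constructor 3; exists u, w1, x1, w2, x2; split; [split | apply: x1max].
Qed.

End Tree.

(** * Budgets of radii *)

Lemma seq_max (L : seq nat) : L != [::] -> exists2 r : nat, r \in L & forall x : nat, x \in L -> x <= r.
Proof.
elim: L => // a L IH _; case: (eqVneq L [::]) => [->|/IH[r rL rmax]].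
  by exists a => [|x]; rewrite inE // => /eqP->.
exists (maxn a r) => [|x]; rewrite inE.
  by case: (leqP a r) => _; rewrite ?rL ?eqxx ?orbT.
by case/orP=> [/eqP->|/rmax]; rewrite leq_max ?leqnn // => ->; rewrite orbT.
Qed.

Lemma seq_min (L : seq nat) : L != [::] -> exists2 r : nat, r \in L & forall x : nat, x \in L -> r <= x.
Proof.
elim: L => // a L IH _; case: (eqVneq L [::]) => [->|/IH[r rL rmin]].
  by exists a => [|x]; rewrite inE // => /eqP->.
exists (minn a r) => [|x]; rewrite inE.
  by case: (leqP a r) => _; rewrite ?rL ?eqxx ?orbT.
by case/orP=> [/eqP->|/rmin]; rewrite geq_min ?leqnn // => ->; rewrite orbT.
Qed.

Lemma size_with_gap (L : seq nat) (lo a b r : nat) : uniq L ->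
  (forall x : nat, x \in L -> lo <= x < r) -> (forall x : nat, x \in L -> ~~ (a <= x <= b)) ->
  size L <= (a - lo) + (r - b.+1).
Proof.
move=> uL rng gap.
rewrite -(size_iota lo (a - lo)) -(size_iota b.+1 (r - b.+1)) -size_cat.
by apply: uniq_leq_size => // x xL; have := gap x xL; have := rng x xL;
  rewrite mem_cat !mem_iota; lia.
Qed.

Lemma size_le_range (L : seq nat) (lo r : nat) : uniq L -> (forall x : nat, x \in L -> lo <= x < r) ->
  size L <= r - lo.
Proof.
move=> uL rng; rewrite -(size_iota lo (r - lo)); apply: uniq_leq_size => // x /rng.
by rewrite mem_iota; lia.
Qed.

(* If a subtree with [n] vertices cannot be removed by any ball of [L], the radii between
   [n / 2] and [n - s - 1] are missing from [L], which therefore is short. *)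
Lemma size_half (L : seq nat) (s0 s r n : nat) : uniq L -> r \in L -> s <= s0 ->
  (forall x : nat, x \in L -> s0 <= x <= r) ->
  (forall x : nat, x \in L -> ~~ ((x + s < n) && (n <= x.*2.+1))) ->
  n <= r + s -> 2 * r + s < 2 * n -> ((size L).-1).*2 <= r.
Proof.
move=> uL rL ss rng gap n1 n2.
have sz : size (rem r L) = (size L).-1 by rewrite size_rem.
have rng' (x : nat) : x \in rem r L -> s0 <= x < r.
  by rewrite mem_rem_uniq // inE => /andP[xr /rng]; lia.
have gap' (x : nat) : x \in rem r L -> ~~ (n./2 <= x <= n - s.+1).
  move=> /mem_rem xL; have := rng x xL; have := gap x xL; lia.
have s1 := size_with_gap (rem_uniq r uL) rng' gap'.
have s2 := size_le_range (rem_uniq r uL) rng'.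
move: s1 s2 (rng r rL); rewrite sz; move: (size L).-1 => N; lia.
Qed.

Lemma size_top_gap (L : seq nat) (s r rho : nat) : uniq L -> r \in L -> rho \in L ->
  (forall x : nat, x \in L -> rho <= x <= r) ->
  (forall x : nat, x \in L -> ~~ ((x + s < r + s) && (r + s <= x.*2.+1))) ->
  rho < r -> s <= rho -> (size L).-1 + rho < r.
Proof.
move=> uL rL pL rng gap pr sp.
have sz : size (rem r L) = (size L).-1 by rewrite size_rem.
have rng' (x : nat) : x \in rem r L -> rho <= x < (r + s)./2.
  by rewrite mem_rem_uniq // inE => /andP[xr xL]; have := rng x xL; have := gap x xL; lia.
have : rho \in rem r L by rewrite mem_rem_uniq // inE pL andbT; lia.
move: (size_le_range (rem_uniq r uL) rng') => le /rng'.
by move: le; rewrite sz; move: (size L).-1 => N; lia.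
Qed.

(* Every radius [rho] of [L] is expected to remove [rho + s + 1] vertices, except that the
   largest radius [K] is used last, on any remaining tree with at most [2 K + 1] vertices.
   The radii [0, ..., s - 1] are reserved for the tips of branches, so spending one of them
   costs [size L]. *)
Definition budget (L : seq nat) (s K : nat) := \sum_(rho <- L) (rho + s + 1) + K.*2.+1.

Lemma budget_shift L s p K : p <= s -> budget L s K = p * size L + budget L (s - p) K.
Proof.
move=> ps; rewrite /budget addnA; congr (_ + _).
elim: L => [|a L IH]; rewrite ?big_nil ?muln0 // !big_cons IH /=; lia.
Qed.

Lemma budget_rem L s p K r : r \in L -> p <= s ->
  budget L s K = r + s + 1 + p * (size L).-1 + budget (rem r L) (s - p) K.
Proof.
move=> rL ps; rewrite -(size_rem rL) -addnA -budget_shift // /budget.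
by rewrite (big_rem _ rL) addnA.
Qed.

Definition avail (L : seq nat) (s K : nat) : pred nat := [pred rho | [|| rho \in L, rho < s | rho == K]].

(** * Covering a tree by balls *)

Section Cover.
Variables (V : finType) (t : rooted_tree V).
Local Notation par := (par t).
Local Notation d := (depth t).
Local Notation root := (tree_root t).
Implicit Types (S A : {set V}) (u v w x y c : V).

Definition coverable (R : pred nat) S :=
  exists f : nat -> V, forall y, y \in S -> exists2 rho, R rho & reach t rho (f rho) y.

Lemma coverable_setD (R1 R2 R : pred nat) A S : coverable R1 A -> coverable R2 (S :\: A) ->
  subpred R1 R -> subpred R2 R -> (forall rho, R1 rho -> ~~ R2 rho) -> coverable R S.
Proof.
move=> [f1 H1] [f2 H2] s1 s2 dis; exists (fun rho => if R1 rho then f1 rho else f2 rho) => y yS.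
case: (boolP (y \in A)) => [/H1[rho r1 re]|yA].
  by exists rho; [apply: s1 | rewrite r1].
have [|rho r2 re] := H2 y; first by rewrite inE yA.
exists rho; first exact: s2; case: ifP => // /dis.
by rewrite r2.
Qed.

Lemma coverable1 (a : nat) c A : (forall y, y \in A -> reach t a c y) -> coverable (pred1 a) A.
Proof. by move=> H; exists (fun=> c) => y /H; exists a => /=. Qed.

Lemma coverable2 (a b : nat) ca cb A : a != b ->
  (forall y, y \in A -> reach t a ca y \/ reach t b cb y) -> coverable (pred2 a b) A.
Proof.
move=> ab H; exists (fun rho => if rho == a then ca else cb) => y /H[] ?.
  by exists a; rewrite /= ?eqxx.
by exists b; rewrite /= ?eqxx ?orbT // eq_sym (negbTE ab).
Qed.

Lemma coverable3 (a b r : nat) ca cb cr A : a != b -> a != r -> b != r ->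
  (forall y, y \in A -> [\/ reach t a ca y, reach t b cb y | reach t r cr y]) ->
  coverable (pred3 a b r) A.
Proof.
move=> ab ar br H.
exists (fun rho => if rho == a then ca else if rho == b then cb else cr) => y /H[] ?.
- by exists a; rewrite /= ?eqxx.
- by exists b; rewrite /= ?eqxx ?orbT // eq_sym (negbTE ab).
- by exists r; rewrite /= ?eqxx ?orbT // !(eq_sym r) (negbTE ar) (negbTE br).
Qed.

Lemma branch_card S m u w x : par_closed t S -> branch t S m u w x ->
  d x - d u <= #|subtree t S w|.
Proof.
move=> cS [w0 pw xW _ _]; have := subtree_height cS xW.
by rewrite -pw depth_par; move: w0; rewrite -depth_eq0; lia.
Qed.

Lemma branch_tips S m u w x q k : par_closed t S -> branch t S m u w x ->
  #|subtree t S w| <= k + q + 1 ->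
  exists c, forall y, y \in subtree t S w ->
    (desc t u y /\ d y - d u <= k) \/ reach t q c y.
Proof.
move=> cS [w0 pw xW _ _] card; have [c Hc] := subtree_tips cS card.
exists c => y yW; have [le|lt] := leqP (d y - d u) k; [left|right].
  by split=> //; have := subtree_child w0 pw yW; rewrite inE => /andP[].
apply: Hc => //; rewrite -depth_eq0 in w0; move: lt; rewrite -pw depth_par; lia.
Qed.

Lemma closed_setD1 S w : par_closed t S -> par_closed t (S :\: subtree t S w).
Proof.
by move=> cS; have := @closed_setD_subtree _ t S set0 w; rewrite setD0 setU0; apply.
Qed.

Lemma root_setD1 S w : w != root -> root \in S -> root \in S :\: subtree t S w.
Proof.
by move=> w0 rS; have := @root_setD_subtree _ t S set0 w w0; rewrite setD0 setU0; apply.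
Qed.

Lemma card_two_branches S m u w1 x1 w2 x2 :
  branch t S m u w1 x1 -> branch t S m u w2 x2 -> w1 != w2 ->
  #|subtree t S w1 :|: subtree t S w2| = #|subtree t S w1| + #|subtree t S w2|.
Proof.
move=> [w10 p1 _ _ _] [w20 p2 _ _ _] w12; rewrite cardsU.
rewrite (_ : _ :&: _ = set0) ?cards0 ?subn0 //; apply/setP => y; rewrite !inE.
apply/negP => /andP[/andP[_ y1] /andP[_ y2]].
case/negP: w12; apply/eqP; apply: desc_same_depth y1 y2.
move: w10 w20 (congr1 d p1) (congr1 d p2); rewrite -!depth_eq0 !depth_par; lia.
Qed.

Lemma subtree_deepest S m u w x : branch t S m u w x -> subtree t S x = [set x].
Proof.
move=> [w0 pw xW mx _]; have [xS wx] : x \in S /\ desc t w x.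
  by move: xW; rewrite inE => /andP.
apply/setP => y; rewrite !inE; apply/idP/eqP => [/andP[yS xy]|->]; last first.
  by rewrite xS desc_refl.
have := mx y; rewrite inE yS (desc_trans wx xy) => /(_ isT) le.
by move: xy; rewrite /desc; move: le; rewrite -subn_eq0 => /eqP-> /eqP.
Qed.

Lemma cover_tree s0 K n : forall (L : seq nat) s S, size L + s <= n ->
  uniq L -> (forall rho : nat, rho \in L -> s0 <= rho < K) -> s <= s0 -> s0 <= K ->
  par_closed t S -> root \in S -> #|S| <= budget L s K ->
  coverable (avail L s K) S.
Proof.
have base S s : par_closed t S -> #|S| <= budget [::] s K -> coverable (avail [::] s K) S.
  rewrite /budget big_nil => cS; rewrite -[in #|S|](subtree_root t S) => /(subtree_small cS)[c Hc].
  exists (fun=> c) => y yS; exists K; first by rewrite /avail /= eqxx orbT.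
  by apply: Hc; rewrite subtree_root.
elim: n => [|n IHn] L s S size_n uL rngL ss0 s0K cS rS cardS.
  by move: size_n cardS; case: (L) => // _; apply: base.
have [L0|Lne] := eqVneq L [::]; first by move: cardS; rewrite L0; apply: base.
have [r rL rmax] := seq_max Lne.
have rngr (x : nat) : x \in L -> s0 <= x <= r by move=> xL; rewrite (rmax _ xL); have /andP[-> _] := rngL _ xL.
have /andP[s0r rK] := rngL _ rL.
have sizeL0 : 0 < size L by case: (L) Lne.
have size_r : size L <= (r - s0).+1.
  rewrite -(size_iota s0 (r - s0).+1); apply: uniq_leq_size => // x /rngr.
  by rewrite mem_iota; lia.
have remove L' s' A (R1 : pred nat) : par_closed t (S :\: A) -> root \in S :\: A ->
    A \subset S -> uniq L' -> {subset L' <= L} -> s' <= s -> size L' + s' < size L + s ->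
    coverable R1 A -> (forall rho, R1 rho -> avail L s K rho && ~~ avail L' s' K rho) ->
    budget L s K <= #|A| + budget L' s' K -> coverable (avail L s K) S.
  move=> cSA rSA sA uL' sL' ss' size' covA R1P le.
  apply: (coverable_setD covA (IHn L' s' (S :\: A) _ _ _ _ _ _ _ _)) => //.
  - by rewrite -ltnS (leq_trans size').
  - by move=> rho /sL'/rngL.
  - exact: leq_trans ss' ss0.
  - rewrite cardsD (setIidPr sA) leq_subLR; exact: leq_trans le.
  - by move=> rho /R1P/andP[].
  - move=> rho /or3P[/sL' h|lt|h]; apply/or3P; [exact: Or31| | exact: Or33].
    by apply: Or32; apply: leq_trans ss'.
  - by move=> rho /R1P/andP[].
have sub_S w : subtree t S w \subset S by apply/subsetP => y; rewrite inE => /andP[].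
have size_rho (rho : nat) : rho \in L -> size (rem rho L) = (size L).-1 by move/size_rem.
have sL (rho : nat) : rho \in L -> (s <= rho) by move=> /rngL/andP[h _]; apply: leq_trans h.
have remove1 w (rho : nat) c : w != root -> rho \in L ->
    (forall y, y \in subtree t S w -> reach t rho c y) ->
    rho + s < #|subtree t S w| -> coverable (avail L s K) S.
  move=> w0 pL Hc lt; apply: (remove (rem rho L) s (subtree t S w) (pred1 rho)) => //.
  - exact: closed_setD1.
  - exact: root_setD1.
  - exact: rem_uniq.
  - exact: mem_rem.
  - by rewrite size_rho //; move: sizeL0; clear; lia.
  - exact: coverable1 Hc.
  - move=> x /= /eqP->; rewrite /avail /= pL /= mem_rem_uniqF //= negb_or -leqNgt sL //=.
    by have /andP[_ pK] := rngL _ pL; rewrite neq_ltn pK.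
  - by rewrite (@budget_rem _ _ 0 _ rho) // mul0n addn0 subn0 leq_add2r addn1.
have [[c Hc]|[u [w [x [bw big]]]]|[u [w1 [x1 [w2 [x2 [[b1 b2 w12 big] le21]]]]]]] := split_tree r cS rS.
- exists (fun=> c) => y /Hc; exists r => //; by rewrite /avail /= rL.
- have [w0 _ _ _ Hc] := bw; apply: (remove1 w r _ w0 rL Hc).
  apply: leq_trans (branch_card cS bw); apply: leq_ltn_trans big.
  by move: (sL _ rL); clear; lia.
have [w10 pw1 x1W x1m H1] := b1; have [w20 pw2 x2W x2m H2] := b2.
have c1 := branch_card cS b1; have c2 := branch_card cS b2.
have [lt1|le1] := ltnP (r + s) #|subtree t S w1|; first exact: (remove1 w1 r _ w10 rL H1).
have [lt2|le2] := ltnP (r + s) #|subtree t S w2|; first exact: (remove1 w2 r _ w20 rL H2).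
have gap w : w != root -> (forall x : nat, x \in L ->
    ~~ ((x + s < #|subtree t S w|) && (#|subtree t S w| <= x.*2.+1))) \/
    coverable (avail L s K) S.
  move=> w0; case: (boolP (has (fun x : nat => (x + s < #|subtree t S w|) &&
                                  (#|subtree t S w| <= x.*2.+1)) L)).
    case/hasP => rho pL /andP[lt le]; right.
    by have [c Hc] := subtree_small cS le; apply: (remove1 w rho c).
  by move/hasPn; left.
have [gap1|//] := gap w1 w10; have [gap2|//] := gap w2 w20.
have s_gt0 : 0 < s.
  by move: le1 c1 big le21; clear; lia.
have removeU L' s' (R1 : pred nat) : uniq L' -> {subset L' <= L} -> s' < s ->
    size L' + s' < size L + s ->
    coverable R1 (subtree t S w1 :|: subtree t S w2) ->
    (forall rho, R1 rho -> avail L s K rho && ~~ avail L' s' K rho) ->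
    budget L s K <= #|subtree t S w1| + #|subtree t S w2| + budget L' s' K ->
    coverable (avail L s K) S.
  rewrite -(card_two_branches b1 b2 w12) => uL' sL' ss' sz cA R1P bud.
  apply: (remove L' s' (subtree t S w1 :|: subtree t S w2) R1) => //; last exact: ltnW.
  - by apply: closed_setD_subtree; apply: closed_setD1.
  - by apply: root_setD_subtree => //; apply: root_setD1.
  - by rewrite subUset !sub_S.
have avail_r p : 0 < p <= s -> avail L s K r && ~~ avail (rem r L) (s - p) K r.
  move=> pp; rewrite /avail /= rL mem_rem_uniqF //=; move: (sL _ rL) rK; clear -pp; lia.
have avail_s (rho : nat) L' s' : {subset L' <= L} -> s' <= rho < s -> avail L s K rho && ~~ avail L' s' K rho.
  move=> sL' /andP[h1 h2]; rewrite /avail /= h2 orbT /=; apply/norP; split.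
    apply/negP => /sL'/sL; by rewrite leqNgt h2.
  by rewrite negb_or -leqNgt h1 neq_ltn (leq_trans h2 (leq_trans ss0 s0K)).
have size_dec p : 0 < p <= s -> size (rem r L) + (s - p) < size L + s.
  by move=> pp; rewrite size_rho //; move: sizeL0; clear -pp; lia.
have reach_u m y : (desc t u y /\ d y - d u <= m) -> reach t m u y.
  by case; apply: reach_down.
have below_u w y : w != root -> par w = u -> y \in subtree t S w -> desc t u y.
  by move=> w0 pw yW; have := subtree_child w0 pw yW; rewrite inE => /andP[].
have sr : s <= r := sL _ rL.
have subr := @mem_rem _ r L; have ur := rem_uniq r uL.
have pay p X : p <= s -> r + s + 1 + p * (size L).-1 <= X ->
    budget L s K <= X + budget (rem r L) (s - p) K.
  by move=> ps le; rewrite (budget_rem _ rL ps) leq_add2r.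
have lt_s1 : s - 1 < s by move: s_gt0; clear; lia.
have av2 rho : pred2 r s.-1 rho -> avail L s K rho && ~~ avail (rem r L) (s - 1) K rho.
  case/orP => /eqP->; first by apply: avail_r; rewrite s_gt0.
  by apply: avail_s => //; rewrite subn1 leqnn prednK /=.
have r_s1 : r != s.-1 by move: sr s_gt0; clear; lia.
have [h2r|rh2] := leqP (d x2 - d u) r.
  have [|c Hc] := @branch_tips S r u w1 x1 s.-1 r cS b1.
    by rewrite -addnA addn1 prednK.
  apply: (removeU (rem r L) (s - 1) (pred2 r s.-1)) => //.
  - by apply: size_dec; rewrite s_gt0.
  - apply: (@coverable2 r s.-1 u c) => // y; rewrite inE => /orP[/Hc[/reach_u|]|yW]; first by left.
      by right.
    left; apply: reach_u; split; first exact: below_u yW.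
    by apply: leq_trans h2r; apply: leq_sub2r; apply: x2m.
  - apply: pay => //; apply: leq_trans (leq_add c1 c2); apply: leq_trans big.
    by move: size_r ss0 s0r sizeL0; clear; lia.
have [small|large] := leqP (#|subtree t S w1| + #|subtree t S w2|) (r.*2 + s).
  have [|c Hc] := @branch_tips S r u w1 x1 s.-1 (r.*2 - (d x2 - d u)) cS b1.
    by move: small c2 le2 sr s_gt0; clear; lia.
  apply: (removeU (rem r L) (s - 1) (pred2 r s.-1)) => //.
  - by apply: size_dec; rewrite s_gt0.
  - apply: (@coverable2 r s.-1 (iter r par x2) c) => // y.
    rewrite inE => /orP[/Hc[[uy le]|]|/H2]; [left | by right | by left].
    exists (d x2 - d u - r), (d y - d u); split.
      by move: le c2 le2 rh2 sr; clear; lia.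
    rewrite -iterD subnK ?(ltnW rh2) // (eqP uy).
    by apply/eqP; apply: below_u x2W.
  - apply: pay => //; apply: leq_trans (leq_add c1 c2); apply: leq_trans big.
    by move: size_r ss0 s0r sizeL0; clear; lia.
have half : ((size L).-1).*2 <= r.
  have [le|lt] := leqP #|subtree t S w2| #|subtree t S w1|.
    by apply: (@size_half _ s0 s r #|subtree t S w1|) => //; move: large le; clear; lia.
  by apply: (@size_half _ s0 s r #|subtree t S w2|) => //; move: large lt; clear; lia.
have two q1 q2 : #|subtree t S w1| <= r + q1 + 1 -> #|subtree t S w2| <= r + q2 + 1 ->
    q1 != q2 -> s - 2 <= q1 < s -> s - 2 <= q2 < s -> 1 < s ->
    coverable (avail L s K) S.
  move=> t1 t2 q12 q1s q2s s1.
  have [a1 Ha1] := branch_tips cS b1 t1; have [a2 Ha2] := branch_tips cS b2 t2.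
  apply: (removeU (rem r L) (s - 2) (pred3 r q1 q2)) => //.
  - by move: s1; clear; lia.
  - by apply: size_dec; rewrite s1.
  - apply: (@coverable3 r q1 q2 u a1 a2) => //; [| |move=> y].
    + by move: q1s sr; clear; lia.
    + by move: q2s sr; clear; lia.
    rewrite inE => /orP[/Ha1|/Ha2] [/reach_u|] h; [exact: Or31|exact: Or32|exact: Or31|exact: Or33].
  - move=> rho /or3P[] /eqP->; [by apply: avail_r; rewrite s1| |]; exact: avail_s.
  - by apply: pay => //; move: large half; clear; lia.
have [both|nboth] := eqVneq (#|subtree t S w1| + #|subtree t S w2|) (r + s).*2; last first.
  have [le|lt] := leqP #|subtree t S w2| #|subtree t S w1|.
    by apply: (two s.-1 s.-2) => //; move: nboth large le rh2 c2 le1 le2; clear; lia.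
  by apply: (two s.-2 s.-1) => //; move: nboth large lt big le21 rh2 c1 le1 le2; clear; lia.
have [n1 n2] : #|subtree t S w1| = r + s /\ #|subtree t S w2| = r + s.
  by move: both le1 le2; clear; lia.
have [one|more] := leqP (size L) 1.
  have s2 := subtree_deepest b2.
  have x20 : x2 != root by rewrite -depth_eq0; move: rh2; clear; lia.
  apply: (remove L (s - 1) (subtree t S x2) (pred1 s.-1)) => //.
  - exact: closed_setD1.
  - exact: root_setD1.
  - exact: ltnW.
  - by rewrite ltn_add2l.
  - by apply: (@coverable1 _ x2) => y; rewrite s2 inE => /eqP->; exists 0, 0.
  - by move=> rho /eqP->; apply: avail_s => //; rewrite subn1 leqnn prednK /=.
  - by rewrite s2 cards1 (budget_shift _ _ s_gt0) mul1n leq_add2r.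
have [rho pL pmin] := seq_min Lne.
have pr : rho < r.
  have : has predT (rem r L) by rewrite has_predT size_rho //; move: more; clear; lia.
  case/hasP => x; rewrite mem_rem_uniq // inE => /andP[/= xr xL] _.
  by move: (pmin _ xL) (rmax _ xL) xr; clear; lia.
have pr' : rho \in rem r L by rewrite mem_rem_uniq // inE pL andbT neq_ltn pr.
have N1 : (size L).-1 + rho < r.
  apply: (@size_top_gap _ s) => //; last exact: sL.
    by move=> x xL; rewrite pmin // rmax.
  by rewrite -n1.
have [|a1 Ha1] := @branch_tips S r u w1 x1 s.-1 r cS b1.
  by rewrite -addnA addn1 prednK.
have [|a2 Ha2] := @branch_tips S r u w2 x2 rho r cS b2.
  by apply: leq_trans le2 _; rewrite -addnA leq_add2l addn1 ltnW // ltnS sL.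
apply: (removeU (rem rho (rem r L)) (s - 1) (pred3 r s.-1 rho)) => //.
- exact: rem_uniq.
- by move=> x /mem_rem/subr.
- by rewrite size_rem // size_rho //; move: more lt_s1; clear; lia.
- apply: (@coverable3 r s.-1 rho u a1 a2) => //; [| |move=> y].
  + by rewrite neq_ltn pr orbT.
  + by move: (sL _ pL) s_gt0; clear; lia.
  by rewrite inE => /orP[/Ha1|/Ha2] [/reach_u|] h; [exact: Or31|exact: Or32|exact: Or31|exact: Or33].
- move=> x /or3P[] /eqP->.
  + have := avail_r 1; rewrite s_gt0 => /(_ isT) /andP[-> /=]; apply: contra.
    by case/or3P => h; apply/or3P; [apply: Or31; apply: mem_rem h|exact: Or32|exact: Or33].
  + by apply: avail_s => [z /mem_rem/subr //|]; rewrite subn1 leqnn prednK /=.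
  + have /andP[_ pK] := rngL _ pL.
    rewrite /avail /= pL mem_rem_uniqF //= negb_or -leqNgt (neq_ltn rho) pK andbT /=.
    by apply: leq_trans (sL _ pL); apply: leq_subr.
rewrite (@budget_rem _ _ 0 _ r) // (@budget_rem _ _ 1 _ rho) ?subn0 // size_rho // n1 n2.
by rewrite addnA leq_add2r; move: N1 more; clear; lia.
Qed.

End Cover.

(** * Burning *)

Section Burning.
Variables (T : finType) (e : rel T).
Implicit Types (B C : {set T}) (s : seq T).

Lemma mem_spread B v : v \in B -> v \in spread e B.
Proof. by rewrite inE => ->. Qed.

Lemma mem_spread_edge B u v : u \in B -> e u v -> v \in spread e B.
Proof. by move=> uB uv; rewrite inE; apply/orP; right; apply/exists_inP; exists u. Qed.

Lemma spreadS B C : B \subset C -> spread e B \subset spread e C.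
Proof.
move=> /subsetP sBC; apply/subsetP => v; rewrite inE => /orP[/sBC/mem_spread//|].
by case/exists_inP => u /sBC; apply: mem_spread_edge.
Qed.

Lemma burned_rcons s x : burned e (rcons s x) = x |: spread e (burned e s).
Proof. by rewrite /burned -cats1 foldl_cat. Qed.

Lemma spread_burned x0 s i : i < size s ->
  iter (size s - i.+1) (spread e) [set nth x0 s i] \subset burned e s.
Proof.
elim/last_ind: s i => // s x IH i; rewrite size_rcons ltnS leq_eqVlt burned_rcons nth_rcons.
case: ltngtP => //= [lt _|-> _]; last by rewrite subnn sub1set setU11.
apply: subset_trans (subsetUr _ _); rewrite subSS -subnSK //=.
exact: spreadS (IH _ lt).
Qed.

Lemma valid_burningP x0 s : reflect
  (forall i, i < size s -> nth x0 s i \notin burned e (take i s)) (valid_burning e s).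
Proof.
apply: (iffP forallP) => vs i; last by rewrite (tnth_nth x0); apply: vs.
by move=> lt; have := vs (Ordinal lt); rewrite (tnth_nth x0).
Qed.

Lemma valid_rcons s x :
  valid_burning e (rcons s x) = valid_burning e s && (x \notin burned e s).
Proof.
apply/(valid_burningP x)/andP => [vs|[/(valid_burningP x) vs xs] i].
  split; last first.
    by have := vs (size s); rewrite size_rcons nth_rcons ltnn eqxx -cats1 take_size_cat //; apply.
  apply/(valid_burningP x) => i lt; have := vs i.
  by rewrite size_rcons nth_rcons lt -cats1 takel_cat ?(ltnW lt) //; apply; rewrite ltnW.
rewrite size_rcons ltnS leq_eqVlt nth_rcons -cats1 => /orP[/eqP->|lt].
  by rewrite ltnn eqxx take_size_cat.
by rewrite lt takel_cat ?(ltnW lt) //; apply: vs.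
Qed.

Lemma valid_size s : valid_burning e s -> size s <= #|burned e s|.
Proof.
elim/last_ind: s => // s x IH; rewrite valid_rcons => /andP[/IH le xs].
rewrite size_rcons burned_rcons; apply: leq_ltn_trans le _; apply: proper_card.
apply/properP; split; last by exists x; rewrite ?setU11.
by apply/subsetP => v /mem_spread vs; rewrite inE vs orbT.
Qed.

(* A choice that is already burned is replaced by an arbitrary unburned vertex. *)
Lemma make_valid s : exists s',
  [/\ valid_burning e s', size s' <= size s & burned e s \subset burned e s'].
Proof.
elim/last_ind: s => [|s x [s' [vs' sz sub]]].
  by exists [::]; split=> //; apply/forallP => - [].
have grow z : spread e (burned e s) \subset z |: spread e (burned e s').
  by apply: subset_trans (spreadS sub) (subsetUr _ _).
case: (set_0Vmem (~: burned e s')) => [full|[y]].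
  exists s'; split=> //; first by rewrite size_rcons ltnW.
  by rewrite -[burned e s']setCK full setC0 subsetT.
rewrite inE => ys'; case: (boolP (x \in burned e s')) => xs'.
  exists (rcons s' y); rewrite !size_rcons !burned_rcons ltnS; split=> //.
    by rewrite valid_rcons vs'.
  by rewrite subUset grow andbT sub1set inE mem_spread ?orbT.
exists (rcons s' x); rewrite !size_rcons !burned_rcons ltnS; split=> //.
  by rewrite valid_rcons vs'.
by rewrite subUset grow andbT sub1set setU11.
Qed.

Lemma burning_number_le s : burned e s = setT -> burning_number e <= size s.
Proof.
move=> full; have [s' [vs' sz sub]] := make_valid s; apply: leq_trans sz.
have full' : burned e s' == setT by rewrite eqEsubset subsetT -full sub.
have b : burns_in e (size s').
  by apply/existsP; exists (in_tuple s'); rewrite vs'.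
rewrite leqNgt; apply/negP => lt.
have le : size s' <= #|T| := leq_trans (valid_size vs') (max_card _).
by have := before_find 0 lt; rewrite nth_iota ?ltnS // add0n b.
Qed.

Lemma bfs_tree (x0 : T) : connected_graph e ->
  exists t : rooted_tree T, forall v, v != tree_root t -> e (par t v) v.
Proof.
move=> conn; pose B i := iter i (spread e) [set x0].
have exB v : exists i, v \in B i.
  have /connectP[p pth ->] := conn x0 v; exists (size p).
  elim/last_ind: p pth => [|p y IH]; first by rewrite inE.
  rewrite rcons_path size_rcons last_rcons => /andP[/IH lB ev] /=.
  exact: mem_spread_edge lB ev.
pose dep v := ex_minn (exB v).
have depB v : v \in B (dep v) by rewrite /dep; case: ex_minnP.
have depmin v i : v \in B i -> dep v <= i by rewrite /dep; case: ex_minnP => j _; apply.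
pose pr v := if [pick u | e u v && ((dep u).+1 == dep v)] is Some u then u else v.
have dep0 v : (dep v == 0) = (v == x0).
  apply/eqP/eqP => [dv|->]; first by have := depB v; rewrite dv inE => /eqP.
  by apply/eqP; rewrite -leqn0 depmin // inE.
have prP v : v != x0 -> e (pr v) v /\ (dep (pr v)).+1 = dep v.
  move=> vx; rewrite /pr; case: pickP => [u /andP[euv /eqP]//|none].
  have := depB v; case dv : (dep v) => [|i]; first by move: vx; rewrite -dep0 dv.
  rewrite /B /= inE => /orP[/depmin|/exists_inP[u uB euv]]; first by rewrite dv ltnn.
  have du : dep u <= i by apply: depmin.
  have : dep v <= (dep u).+1 by apply: depmin; apply: mem_spread_edge (depB u) euv.
  rewrite dv ltnS => di; have := none u; rewrite euv dv eqSS /=.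
  by rewrite eqn_leq du di.
have pr0 : pr x0 = x0.
  rewrite /pr; case: pickP => // u /andP[_].
  by have /eqP -> : dep x0 == 0; rewrite ?dep0.
have deppr v : dep (pr v) = (dep v).-1.
  have [->|/prP[_ <-]//] := eqVneq v x0; rewrite pr0.
  by have /eqP -> : dep x0 == 0; rewrite ?dep0.
by exists (RootedTree pr0 dep0 deppr) => v /prP[].
Qed.

Lemma reach_spread (t : rooted_tree T) : symmetric e ->
  (forall v, v != tree_root t -> e (par t v) v) ->
  forall m c y, reach t m c y -> y \in iter m (spread e) [set c].
Proof.
move=> sym ed m c y [a [b [le eq_ab]]].
have edge v : v = par t v \/ e v (par t v).
  have [->|/ed] := eqVneq v (tree_root t); first by left; rewrite par_root.
  by rewrite sym; right.
have up i : iter i (par t) c \in iter i (spread e) [set c].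
  elim: i => [|i IH] /=; first by rewrite inE.
  by case: (edge (iter i (par t) c)) => [<-|]; [apply: mem_spread | apply: mem_spread_edge].
have down i : forall B v, iter i (par t) v \in B -> v \in iter i (spread e) B.
  elim: i => //= i IH B v vB; rewrite -iterS iterSr; apply: IH.
  case: (edge (iter i (par t) v)) => [->|ev]; first exact: mem_spread.
  by apply: mem_spread_edge vB _; rewrite sym.
have : y \in iter b (spread e) (iter a (spread e) [set c]).
  by apply: down; rewrite -eq_ab.
rewrite -iterD addnC => yB; rewrite -(subnK le) iterD.
by elim: (m - (a + b)) => //= n; apply: mem_spread.
Qed.

End Burning.

Lemma budget_iota a n s K :
  2 * budget (iota a n) s K = n * (2 * a + n.-1 + 2 * s + 2) + 4 * K + 2.
Proof.
have -> : 2 * budget (iota a n) s K = 2 * \sum_(rho <- iota a n) (rho + s + 1) + 4 * K + 2.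
  by rewrite /budget; lia.
congr (_ + _ + _); elim: n a => [|n IH] a; first by rewrite big_nil.
by rewrite /= big_cons mulnDr IH; nia.
Qed.

(* [s0 = k / 3] (rounded) maximizes the initial budget. *)
Lemma budget_init n k (s0 := k.+1 %/ 3) : 1 < k -> 3 * n + 3 <= 2 * k ^ 2 + 3 * k ->
  n <= budget (iota s0 (k.-1 - s0)) s0 k.-1.
Proof.
move=> k2 le; rewrite -(leq_pmul2l (ltn0Sn 1)) budget_iota.
have : [\/ k = 3 * s0, k = 3 * s0 + 1 | k + 1 = 3 * s0].
  have [|[|]] : k = 3 * s0 \/ k = 3 * s0 + 1 \/ k + 1 = 3 * s0 by rewrite /s0; lia.
  - exact: Or31.
  - exact: Or32.
  - exact: Or33.
move: s0 => m [] ek.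
- have [p ep] : exists p, m = p.+1 by exists m.-1; lia.
  have -> : k.-1 - m = (2 * p).+1 by lia.
  rewrite ek ep in le *; rewrite /=; nia.
- have -> : k.-1 - m = 2 * m by lia.
  have -> : k.-1 = 3 * m by lia.
  have [p ep] : exists p, m = p.+1 by exists m.-1; lia.
  rewrite ek ep in le *; nia.
- have [p ep] : exists p, m = p.+1 by exists m.-1; lia.
  have -> : k.-1 - m = 2 * p by lia.
  have -> : k.-1 = 3 * p + 1 by lia.
  have ek' : k = 3 * p + 2 by lia.
  have [p0|[q eq]] : p = 0 \/ exists q, p = q.+1 by case: p {ep ek'} => [|q]; [left|right; exists q].
    rewrite ek' ep p0 in le *; nia.
  rewrite ek' ep eq in le *; nia.
Qed.

Lemma burning_number_bound (T : finType) (e : rel T) k :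
  simple_graph e -> connected_graph e -> 3 * #|T| + 3 <= 2 * k ^ 2 + 3 * k ->
  burning_number e <= k.
Proof.
move=> [sym _] conn bound; case: (pickP T) => [x0 _|none]; last first.
  apply: (@leq_trans 0) => //; apply: (@burning_number_le _ e [::]).
  by apply/setP => x; have := none x.
have n0 : 0 < #|T| by apply/card_gt0P; exists x0.
have k2 : 1 < k by case: k bound => [|[|k]] //; move: #|T| n0 => n; lia.
have [t edt] := bfs_tree x0 conn.
have := budget_init k2 bound; set s0 := _ %/ 3; set K := k.-1; rewrite -cardsT => card.
have s0K : s0 <= K by rewrite /s0 /K; lia.
have rng (rho : nat) : rho \in iota s0 (K - s0) -> s0 <= rho < K by rewrite mem_iota; lia.
have [f cov] : coverable t (avail (iota s0 (K - s0)) s0 K) [set: T].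
  by apply: cover_tree (leqnn _) (iota_uniq _ _) rng _ _ _ _ card => // y; rewrite inE.
pose bs := mkseq (fun i => f (K - i)) k.
have szk : size bs = k by rewrite size_mkseq.
rewrite -szk; apply: burning_number_le; apply/eqP; rewrite -subTset.
apply/subsetP => y /cov[rho av rho_y].
have lt : rho < k.
  have : rho <= K by case/or3P: av => [/rng/andP[_ /ltnW]//|lt|/eqP->//]; exact: leq_trans (ltnW lt) s0K.
  by rewrite /K -ltnS prednK // ltnW.
have lt' : K - rho < k by rewrite /K; lia.
have := @spread_burned _ e x0 bs (K - rho); rewrite szk nth_mkseq // => /(_ lt') /subsetP; apply.
have -> : k - (K - rho).+1 = rho by rewrite /K; lia.
have -> : K - (K - rho) = rho by rewrite /K; lia.
exact: reach_spread rho_y.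
Qed.

Local Open Scope ring_scope.

Theorem theorem1 (R : archiRcfType) (T : finType) (e : rel T) :
  simple_graph e -> connected_graph e ->
  ((burning_number e)%:Z <=
     Num.ceil ((-3 + Num.sqrt (24 * (#|T|)%:R + 33)) / 4 : R))%R.
Proof.
move=> sg cg; set n := #|T|; set a : R := Num.sqrt _.
have a3 : 3 <= a.
  have -> : 3 = Num.sqrt (3 ^+ 2) :> R by rewrite sqrtr_sqr ger0_norm.
  rewrite ler_sqrt; have : 0 <= n%:R :> R by [].
    lra.
  lra.
have := Num.Theory.ceil_ge ((-3 + a) / 4); set c := Num.ceil _ => le_c.
have c0 : 0 <= c by rewrite -(ler_int R); apply: le_trans le_c; lra.
move: c0 le_c; case: c => // k _ le_c; rewrite lez_nat.
apply: burning_number_bound => //.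
have ak : a <= 4 * k%:R + 3 by move: le_c; rewrite -pmulrn; lra.
have sq : 24 * n%:R + 33 <= (4 * k%:R + 3) ^+ 2 :> R.
  rewrite -(@sqr_sqrtr _ (24 * n%:R + 33)); last by have : 0 <= n%:R :> R by []; lra.
  have k0 : 0 <= k%:R :> R by [].
  by rewrite ler_sqr ?nnegrE ?sqrtr_ge0 //; move: k0; lra.
rewrite -(ler_nat R) !natrD !natrM; lra.
Qed.
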